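(* Let $G, A, B$ be small profinite groups such that $G\times A\cong G\times B$. Then $A\cong B$. That is, every small profinite group is cancellable in the class of small profinite groups.
   Context: All homomorphisms and isomorphisms between profinite groups are continuous. A profinite group $G$ is small if for every $n\in\mathbb{N}$ it has only finitely many open normal subgroups of index $n$. A group $G$ is cancellable in a category $\mathcal{C}$ of groups if $G\times A\cong G\times B$ implies $A\cong B$ for all $A,B\in\mathcal{C}$ (with isomorphisms in $\mathcal{C}$). *)

(* Defs.v *)
From HB Require Import structures.
From mathcomp Require Import all_boot.
From mathcomp Require Import all_classical.
From mathcomp Require Import topology.

Set Implicit Arguments.
Unset Strict Implicit.
Unset Printing Implicit Defensive.

Local Open Scope classical_set_scope.
Local Open Scope card_scope.
Local Open Scope group_scope.

HB.structure Definition PreTopologicalGroup :=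
  {G of Topological G & Group G}.

HB.mixin Record PreTopologicalGroup_isTopologicalGroup G
    & PreTopologicalGroup G := {
  mulg_continuous : continuous (fun x : G * G => x.1 * x.2) ;
  invg_continuous : continuous (fun x : G => x^-1) ;
}.

#[short(type="topologicalGroupType")]
HB.structure Definition TopologicalGroup :=
  {G of PreTopologicalGroup G & PreTopologicalGroup_isTopologicalGroup G}.

Section ProductGroup.
Variables G H : topologicalGroupType.

Lemma pair_mulg_continuous :
  continuous (fun x : (G * H) * (G * H) => x.1 * x.2).
Proof.
move=> [[x1 x2] [y1 y2]].
pose F := nbhs ((x1, x2), (y1, y2)).
have fstE : fst @ F --> (x1, x2) by exact: cvg_fst.
have sndE : snd @ F --> (y1, y2) by exact: cvg_snd.
have mulG : (fun u : (G * H) * (G * H) => u.1.1 * u.2.1) @ F --> x1 * y1.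
  apply: (continuous2_cvg _ (@mulg_continuous G (x1, y1))).
  - exact: cvg_comp fstE cvg_fst.
  - exact: cvg_comp sndE cvg_fst.
have mulH : (fun u : (G * H) * (G * H) => u.1.2 * u.2.2) @ F --> x2 * y2.
  apply: (continuous2_cvg _ (@mulg_continuous H (x2, y2))).
  - exact: cvg_comp fstE cvg_snd.
  - exact: cvg_comp sndE cvg_snd.
exact: cvg_pair mulG mulH.
Qed.

Lemma pair_invg_continuous : continuous (fun x : G * H => x^-1).
Proof.
move=> [x y].
have invG : (fun u : G * H => u.1^-1) @ nbhs (x, y) --> x^-1.
  by apply: (cvg_comp fst (fun z : G => z^-1) cvg_fst);
    exact: invg_continuous.
have invH : (fun u : G * H => u.2^-1) @ nbhs (x, y) --> y^-1.
  by apply: (cvg_comp snd (fun z : H => z^-1) cvg_snd);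
    exact: invg_continuous.
exact: cvg_pair invG invH.
Qed.

HB.instance Definition _ :=
  PreTopologicalGroup_isTopologicalGroup.Build (G * H)%type
    pair_mulg_continuous pair_invg_continuous.

End ProductGroup.

Definition isomorphic (G H : topologicalGroupType) : Prop :=
  exists (f : {multiplicative G -> H}) (g : {multiplicative H -> G}),
    [/\ continuous f, continuous g, cancel f g & cancel g f].

Definition profinite (G : topologicalGroupType) : Prop :=
  [/\ hausdorff_space G, compact [set: G] & totally_disconnected [set: G]].

Definition normal_subgroup (G : groupType) (N : set G) : Prop :=
  group_closed (mem N) /\ forall x y, N x -> N (x ^ y).

Definition lcosets (G : groupType) (N : set G) : set (set G) :=
  range (fun x : G => [set x * y | y in N]).

Definition small (G : topologicalGroupType) : Prop :=
  forall n : nat, finite_set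
    [set N : set G | [/\ open N, normal_subgroup N & lcosets N #= `I_n]].

Definition small_profinite (G : topologicalGroupType) : Prop :=
  profinite G /\ small G.

(* A class C of topological groups stands for the full subcategory it spans,
   with continuous homomorphisms as morphisms. *)
Definition cancellable (C : topologicalGroupType -> Prop)
    (G : topologicalGroupType) : Prop :=
  forall A B : topologicalGroupType, C A -> C B ->
    isomorphic (G * A)%type (G * B)%type -> isomorphic A B.

(* Main.v *)
(* Let [core n X] be the intersection of the open normal subgroups of [X] of index
   at most [n].  It is functorial under continuous homomorphisms, so that
   [core n (G * A) = core n G * core n A] and [G * A ~ G * B] induces an
   isomorphism modulo [core n]; smallness makes these quotients finite.  Finite
   groups cancel by Lovasz's argument: for finite [F],
   |Hom(F, G * A)| = |Hom(F, G)| |Hom(F, A)|, hence |Hom(F, A)| = |Hom(F, B)|,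
   and sorting homomorphisms by their kernels gives the same equality for
   injective ones; take F = A.  The resulting isomorphisms [A / core n -> B / core n]
   lift to arbitrary maps [t n : A -> B], and the limit of [t n] along a
   nonprincipal ultrafilter on [nat] is an isomorphism [A -> B]. *)
From HB Require Import structures.
From mathcomp Require Import all_boot.
From mathcomp Require Import all_classical.
From mathcomp Require Import topology.
Require Import Defs.

Set Implicit Arguments.
Unset Strict Implicit.
Unset Printing Implicit Defensive.

(** * Cancellation for finite sets with one binary operation *)

Definition op_hom (X Y : Type) (mX : X -> X -> X) (mY : Y -> Y -> Y)
    (f : X -> Y) : Prop := forall x y, f (mX x y) = mY (f x) (f y).

Definition prod_op (X Y : Type) (mX : X -> X -> X) (mY : Y -> Y -> Y)
  (p q : X * Y) : X * Y := (mX p.1 q.1, mY p.2 q.2).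

Definition fker (F A : finType) (f : F -> A) : {set F * F} :=
  [set p | f p.1 == f p.2].

(* Constraining the kernel relation of maps out of [F] to contain [E] plays the
   role of replacing [F] by its quotients, and no group axiom is needed. *)
Definition homs (F A : finType) (mF : F -> F -> F) (mA : A -> A -> A)
    (E : {set F * F}) : {set {ffun F -> A}} :=
  [set f : {ffun F -> A} |
    [forall x, forall y, f (mF x y) == mA (f x) (f y)] && (E \subset fker f)].

Definition homs_ker (F A : finType) (mF : F -> F -> F) (mA : A -> A -> A)
    (E : {set F * F}) : {set {ffun F -> A}} :=
  [set f in homs mF mA E | fker f == E].

Lemma homsP (F A : finType) (mF : F -> F -> F) (mA : A -> A -> A)
    (E : {set F * F}) (f : {ffun F -> A}) :
  reflect (op_hom mF mA f /\ forall x y, (x, y) \in E -> f x = f y)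
          (f \in homs mF mA E).
Proof.
rewrite inE; apply: (iffP andP) => -[fM fE]; split.
- by move=> x y; move/forallP/(_ x)/forallP/(_ y)/eqP: fM.
- by move=> x y /(fintype.subsetP fE); rewrite inE => /eqP.
- by apply/forallP => x; apply/forallP => y; rewrite fM.
- by apply/fintype.subsetP => -[x y] /fE fxy; rewrite inE; apply/eqP.
Qed.

(** A map into a product is a pair of maps, and its kernel relation is the intersection of
    theirs. *)
Lemma card_homs_prod (F G A : finType) (mF : F -> F -> F) (mG : G -> G -> G)
    (mA : A -> A -> A) (E : {set F * F}) :
  #|homs mF (prod_op mG mA) E| = (#|homs mF mG E| * #|homs mF mA E|)%N.
Proof.
pose pr (p : {ffun F -> G} * {ffun F -> A}) := [ffun x => (p.1 x, p.2 x)].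
have pr_inj : injective pr.
  move=> [f g] [f' g'] /ffunP e; congr (_, _); apply/ffunP => x;
  by have := e x; rewrite !ffunE => -[].
rewrite -cardsX -(card_imset _ pr_inj); congr #|pred_of_set _|.
apply/setP => h; apply/homsP/imsetP => [[hM hE]|[[f g]]].
- exists ([ffun x => (h x).1], [ffun x => (h x).2]); last first.
    by apply/ffunP => x; rewrite !ffunE; case: (h x).
  rewrite inE /=; apply/andP; split; apply/homsP; split=> x y;
    by [rewrite !ffunE hM | move=> /hE; rewrite !ffunE => ->].
- rewrite inE => /andP[/homsP[fM fE] /homsP[gM gE]] ->; split=> x y.
    by rewrite !ffunE fM gM.
  by move=> xy; rewrite !ffunE (fE _ _ xy) (gE _ _ xy).
Qed.

(** Postcomposition with [phi] is injective. Used in both directions, this equates the counts of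
    maps into [G * A] and into [G * B]. *)
Lemma leq_homs_inj (F A B : finType) (mF : F -> F -> F) (mA : A -> A -> A)
    (mB : B -> B -> B) (phi : A -> B) (E : {set F * F}) :
  injective phi -> op_hom mA mB phi ->
  #|homs mF mA E| <= #|homs mF mB E|.
Proof.
move=> phi_inj phiM.
pose post (f : {ffun F -> A}) := [ffun x => phi (f x)].
have post_inj : injective post.
  by move=> f g /ffunP e; apply/ffunP => x; have := e x; rewrite !ffunE => /phi_inj.
rewrite -(card_imset _ post_inj); apply/subset_leq_card/fintype.subsetP => h.
move=> /imsetP[f /homsP[fM fE] ->]; apply/homsP; split=> x y.
  by rewrite !ffunE fM phiM.
by move=> /fE; rewrite !ffunE => ->.
Qed.

Lemma card_homs_ker (F A : finType) (mF : F -> F -> F) (mA : A -> A -> A)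
    (E : {set F * F}) :
  #|homs mF mA E| = \sum_(E' : {set F * F} | E \subset E') #|homs_ker mF mA E'|.
Proof.
rewrite -sum1_card.
rewrite (partition_big (fun f : {ffun F -> A} => fker f)
  (fun E' : {set F * F} => E \subset E')) /=; last by move=> f; rewrite inE => /andP[].
apply: eq_bigr => E' EE'; rewrite sum1_card; apply: eq_card => f.
rewrite !inE unfold_in /= inE -!andbA; congr (_ && _).
by case: eqP => [->|]; rewrite ?andbF// EE' subxx.
Qed.

(** Möbius inversion by induction from larger relations down to [E]: in the sum over relations
    containing [E] all other terms agree, so the term at [E] does too. *)
Lemma card_homs_ker_eq (F A B : finType) (mF : F -> F -> F)
    (mA : A -> A -> A) (mB : B -> B -> B) :
  (forall E, #|homs mF mA E| = #|homs mF mB E|) ->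
  forall E, #|homs_ker mF mA E| = #|homs_ker mF mB E|.
Proof.
move=> eqAB E; have [n] := ubnP #|~: E|; elim: n E => // n IHn E.
rewrite ltnS => leE; have := eqAB E.
rewrite !card_homs_ker (bigD1 E) //= [in RHS](bigD1 E) //=.
rewrite (eq_bigr (fun E' => #|homs_ker mF mB E'|)); first by move/addIn.
move=> E' /andP[sEE' neE']; apply: IHn; apply: leq_trans leE.
by apply: proper_card; rewrite properC finset.properEneq eq_sym neE'.
Qed.

Lemma finite_cancellation (G A B : finType) (mG : G -> G -> G)
    (mA : A -> A -> A) (mB : B -> B -> B) (e : G)
    (phi : G * A -> G * B) (psi : G * B -> G * A) :
  mG e e = e ->
  injective phi -> op_hom (prod_op mG mA) (prod_op mG mB) phi ->
  injective psi -> op_hom (prod_op mG mB) (prod_op mG mA) psi ->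
  exists (t : A -> B) (s : B -> A),
    [/\ op_hom mA mB t, op_hom mB mA s, cancel t s & cancel s t].
Proof.
move=> ee phi_inj phiM psi_inj psiM.
have eq_homs E : #|homs mA mA E| = #|homs mA mB E|.
  (* The constant map at the idempotent [e] satisfies every constraint [E], so the factor for [G]
     can be cancelled. *)
  have GE_gt0 : 0 < #|homs mA mG E|.
    apply/card_gt0P; exists [ffun=> e]; apply/homsP.
    by split=> x y; rewrite !ffunE.
  apply/eqP; rewrite -(eqn_pmul2l GE_gt0) -!card_homs_prod eqn_leq.
  by rewrite (leq_homs_inj _ _ phi_inj phiM) (leq_homs_inj _ _ psi_inj psiM).
(* The kernel relation of the identity is the diagonal, so injective homomorphisms are counted; into
   [A], the identity is one. *)
have : 0 < #|homs_ker mA mB (fker (@id A))|.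
  rewrite -(card_homs_ker_eq eq_homs); apply/card_gt0P; exists [ffun x => x].
  rewrite inE; apply/andP; split; last first.
    by apply/eqP/setP => p; rewrite !inE !ffunE.
  by apply/homsP; split=> x y; rewrite ?inE !ffunE // => /eqP.
case/card_gt0P => t; rewrite inE => /andP[/homsP[tM _] /eqP/setP tker].
have t_inj : injective t.
  by move=> x y txy; have := tker (x, y); rewrite !inE /= txy eqxx => /esym/eqP.
have G_gt0 : 0 < #|G| by apply/card_gt0P; exists e.
have leBA : #|B| <= #|A|.
  by rewrite -(leq_pmul2l G_gt0) -!card_prod; exact: leq_card psi_inj.
have [s ts st] := inj_card_bij t_inj leBA.
exists t, s; split=> // x y.
by apply: t_inj; rewrite tM !st.
Qed.

(** * Clopen sets in totally disconnected compact spaces *)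

Local Open Scope classical_set_scope.

(** The quasi-component [Q] of [x], the intersection of its clopen neighbourhoods, is connected by
    compactness and hence reduced to [x]. *)
Lemma totally_disconnected_zero_dimensional (T : topologicalType) :
  hausdorff_space T -> compact [set: T] -> totally_disconnected [set: T] ->
  zero_dimensional T.
Proof.
move=> hT cT tdT x y xy.
pose Q := \bigcap_(U in [set U : set T | clopen U /\ U x]) U.
apply: contrapT => noU.
have Qx : Q x by move=> U [].
have Qy : Q y.
  by move=> U [cU Ux]; apply: contrapT => nUy; apply: noU; exists U.
have clQ : closed Q by apply: closed_bigI => U [[]].
suff cQ : connected Q.
  have := connected_component_max Qx (@subsetT _ _) cQ.
  by rewrite tdT// => /(_ _ Qy) /= yx; move: xy; rewrite yx eqxx.
(* Connectedness in terms of separations: if two disjoint closed sets cover [Q], the one containing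
   [x] contains [Q]. *)
suff key C D : closed C -> closed D -> Q `<=` C `|` D -> C `&` D `<=` set0 ->
    C x -> Q `<=` C.
  move=> B B0 [V oV BV] [C clC BC].
  have QCV : Q `&` C = Q `&` V by rewrite -BC.
  have clQC : closed (Q `&` C) by exact: closedI.
  have clQV : closed (Q `&` ~` V) by apply: closedI => //; exact: open_closedC.
  have disj : (Q `&` C) `&` (Q `&` ~` V) `<=` set0.
    by rewrite QCV => z [[_ ?] []].
  have cov : Q `<=` (Q `&` C) `|` (Q `&` ~` V).
    by rewrite QCV => z Qz; have [|] := pselect (V z); [left|right].
  have [QCx|nQCx] := pselect ((Q `&` C) x).
    rewrite BC; apply/seteqP; split; first by move=> ? [].
    by apply: (key _ _ clQC clQV cov disj).
  have : Q `<=` Q `&` ~` V.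
    apply: (key _ _ clQV clQC); first by rewrite setUC.
      by rewrite setIC.
    by have [//|] := cov _ Qx.
  by case: B0 => z; rewrite BV => -[Qz Vz] /(_ _ Qz)[].
move=> clC clD QCD CD0 Cx z Qz.
have CnD : set_nbhs C (~` D).
  move=> w Cw; apply: open_nbhs_nbhs; split; first exact: closed_openC.
  by move=> Dw; apply: (CD0 w).
have [U CU UD] := compact_normal hT cT clC CnD.
have oUC : C `<=` U^° by exact: CU.
have QU : Q `&` closure U `<=` U^°.
  by move=> w [/QCD[/oUC//|Dw] /UD].
(* The boundary of [U] is compact and misses [Q], so clopen neighbourhoods of [x], directed by
   shrinking, eventually avoid it. *)
have /compact_near_coveringP cK : compact (closure U `\` U^°).
  apply: (subclosed_compact _ cT) => //.
  apply: closedI; first exact: closed_closure.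
  by apply: open_closedC; exact: open_interior.
pose D0 := [set W : set T | clopen W /\ W x].
pose F := filter_from D0 (fun W => [set W' | D0 W' /\ W' `<=` W]).
have FF : Filter F.
  apply: filter_from_filter.
    by exists setT; split=> //; split; [exact: openT|exact: closedT].
  move=> V W [[oV cV] Vx] [[oW cW] Wx]; exists (V `&` W).
    by split=> //; split; [exact: openI|exact: closedI].
  by move=> W' [DW' W'VW]; split; split=> // w /W'VW[].
have [w [clUw nUw]|W DW KW] := cK _ F (fun W w => ~ W w) FF.
  have [W DW nWw] : exists2 W, D0 W & ~ W w.
    apply: contrapT => noW; apply: nUw; apply: QU; split=> // W DW.
    by apply: contrapT => nWw; apply: noW; exists W.
  exists (~` W, [set W' | D0 W' /\ W' `<=` W]) => /=; last first.
    by move=> [w' W'] /= [nWw' [_ W'W]] /W'W.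
  split; last by exists W.
  by apply: open_nbhs_nbhs; split=> //; apply: closed_openC; case: DW => -[].
have {}KW : closure U `\` U^° `<=` ~` W by apply: KW; split.
case: (DW) => -[oW clW] Wx.
(* As [W] avoids the boundary of [U], its trace on [U^°] is clopen; it contains [x], hence [Q]. *)
have WUE : W `&` closure U = W `&` U^°.
  apply/seteqP; split=> w [Ww Uw]; split=> //; last first.
    by apply: subset_closure; exact: interior_subset.
  by apply: contrapT => nUw; apply: (KW w).
have QWU : Q `<=` W `&` U^°.
  apply: bigcap_inf; split; last by split=> //; exact: oUC.
  split; first by apply: openI => //; exact: open_interior.
  by rewrite -WUE; apply: closedI => //; exact: closed_closure.
have [_ Uz] := QWU _ Qz; have [//|Dz] := QCD _ Qz.
case: (UD z) => //; apply: subset_closure; exact: interior_subset.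
Qed.

(** * Normal subgroups, congruences and index *)

Local Open Scope card_scope.
Local Open Scope group_scope.

Lemma cvg_mulg (X : topologicalGroupType) (T : Type) (F : set_system T)
    {FF : Filter F} (f g : T -> X) (x y : X) :
  f @ F --> x -> g @ F --> y -> (fun t => f t * g t) @ F --> x * y.
Proof. exact: (continuous2_cvg _ (@mulg_continuous X (x, y))). Qed.

Lemma morph_oneg (X Y : groupType) (f : X -> Y) :
  {morph f : x y / x * y} -> f 1 = 1.
Proof. by move=> fM; apply: (mulgI (f 1)); rewrite -fM !mulg1. Qed.

Lemma morph_invg (X Y : groupType) (f : X -> Y) :
  {morph f : x y / x * y} -> {morph f : x / x^-1}.
Proof.
by move=> fM x; apply: (mulgI (f x)); rewrite -fM !mulgV morph_oneg.
Qed.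

Section NormalSubgroup.
Variables (X : groupType) (N : set X).
Hypothesis nN : normal_subgroup N.

Lemma normal_subgroup1 : N 1.
Proof. by case: nN => -[] /set_mem. Qed.

Lemma normal_subgroup_div x y : N x -> N y -> N (x * y^-1).
Proof.
case: nN => -[_ Ndiv _] Nx Ny; apply: set_mem.
by apply: Ndiv; exact: mem_set.
Qed.

Lemma normal_subgroupV x : N x -> N x^-1.
Proof.
by move=> Nx; rewrite -[x^-1]mul1g; apply: normal_subgroup_div => //; exact: normal_subgroup1.
Qed.

Lemma normal_subgroupM x y : N x -> N y -> N (x * y).
Proof.
move=> Nx Ny; rewrite -[y]invgK; apply: normal_subgroup_div => //.
exact: normal_subgroupV.
Qed.

Lemma normal_subgroupJ x y : N x -> N (x ^ y).
Proof. by case: nN => _; apply. Qed.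

End NormalSubgroup.

Lemma normal_subgroup_intro (X : groupType) (N : set X) :
  N 1 -> (forall x, N x -> N x^-1) -> (forall x y, N x -> N y -> N (x * y)) ->
  (forall x y, N x -> N (x ^ y)) -> normal_subgroup N.
Proof.
move=> N1 NV NM NJ; split=> //; split; first exact: mem_set.
by move=> x y /set_mem Nx /set_mem Ny; apply: mem_set; apply: NM => //; exact: NV.
Qed.

Definition eqmod (X : groupType) (N : set X) (x y : X) : Prop := N (x^-1 * y).

Section Eqmod.
Variables (X : groupType) (N : set X).
Hypothesis nN : normal_subgroup N.

Lemma eqmod_refl x : eqmod N x x.
Proof. by rewrite /eqmod mulVg; exact: normal_subgroup1. Qed.

Lemma eqmod_sym x y : eqmod N x y -> eqmod N y x.
Proof. by move=> /(normal_subgroupV nN); rewrite /eqmod invgM invgK. Qed.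

Lemma eqmod_trans x y z : eqmod N x y -> eqmod N y z -> eqmod N x z.
Proof.
by move=> /(normal_subgroupM nN) /[apply]; rewrite /eqmod mulgA mulgK.
Qed.

Lemma eqmodM x y x' y' :
  eqmod N x x' -> eqmod N y y' -> eqmod N (x * y) (x' * y').
Proof.
move=> /(normal_subgroupJ nN y) xx' yy'.
have := normal_subgroupM nN xx' yy'.
by rewrite /eqmod conjgE invgM !mulgA mulgK.
Qed.

Lemma eqmod1 x : eqmod N 1 x <-> N x.
Proof. by rewrite /eqmod invg1 mul1g. Qed.

Lemma eqmod_mulr x y : N y -> eqmod N x (x * y).
Proof. by rewrite /eqmod mulKg. Qed.

End Eqmod.

(* "Of index at most [n]" is phrased through a labelling of the cosets so that
   it is inherited by preimages without any cardinal arithmetic. *)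
Definition index_le (X : groupType) (n : nat) (N : set X) : Prop :=
  exists c : X -> 'I_n, forall x y, c x = c y -> eqmod N x y.

(** Openness is put as [nbhs 1 N], equivalent for a subgroup and easier to pull back along a map. *)
Definition core (X : topologicalGroupType) (n : nat) : set X :=
  [set x | forall N : set X,
    normal_subgroup N -> nbhs 1 N -> index_le n N -> N x].

Lemma index_le_card (X : groupType) (n : nat) (N : set X) :
  normal_subgroup N -> index_le n N ->
  exists2 k : nat, k <= n & lcosets N #= `I_k.
Proof.
move=> nN [c cN].
pose R (y : X) := [set y * z | z in N].
have eqR x y : eqmod N x y -> R x = R y.
  move=> xy; apply/seteqP; split=> _ [z Nz <-]; last first.
    exists (x^-1 * y * z); last by rewrite !mulgA mulgV mul1g.
    exact: normal_subgroupM.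
  exists (y^-1 * x * z); last by rewrite !mulgA mulgV mul1g.
  by apply: normal_subgroupM => //; exact: eqmod_sym.
(* A coset gets the label of a chosen representative; the default [1] is mere filler, since an
   actual coset has a representative. *)
pose h (C : set X) := val (c (xget 1 [set x | C = R x])).
have hP C : lcosets N C -> C = R (xget 1 [set x | C = R x]).
  move=> [x _ xC]; exact: (xgetPex 1 (ex_intro (fun x => C = R x) x (esym xC))).
have h_inj : {in lcosets N &, injective h}.
  move=> C D /set_mem/hP CE /set_mem/hP DE /val_inj/cN /eqR.
  by rewrite -CE -DE.
have le_n : lcosets N #<= `I_n.
  apply: card_le_trans (subset_card_le (_ : h @` lcosets N `<=` _)).
    have := inj_card_eq h_inj.
    by rewrite card_eq_sym card_eq_le => /andP[].
  by move=> _ [C _ <-] /=; exact: ltn_ord.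
have [k ek] : exists k, lcosets N #= `I_k.
  by apply/finite_setP/finite_set_leP; exists n.
by exists k => //; rewrite -card_le_II -(card_le_eql ek).
Qed.

(** * Cores as open normal subgroups *)

Section Core.
Variable X : topologicalGroupType.

Lemma core_normal n : normal_subgroup (@core X n).
Proof.
apply: normal_subgroup_intro => [|x Cx|x y Cx Cy|x y Cx] N nN oN iN.
- exact: normal_subgroup1.
- by apply: normal_subgroupV => //; exact: Cx.
- by apply: normal_subgroupM => //; [exact: Cx|exact: Cy].
- by apply: normal_subgroupJ => //; exact: Cx.
Qed.

Lemma core_le m n : (m <= n)%N -> @core X n `<=` @core X m.
Proof.
move=> mn x Cx N nN oN [c cN]; apply: Cx => //.
by exists (fun x => widen_ord mn (c x)) => y z /(congr1 val) /= /val_inj/cN.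
Qed.

Lemma nbhs_eqmod (x : X) (N : set X) : nbhs 1 N -> nbhs x (eqmod N x).
Proof.
move=> N1.
have cx : (fun y : X => x^-1 * y) @ x --> x^-1 * x.
  by apply: cvg_mulg; [exact: cvg_cst|exact: cvg_id].
by apply: cx; rewrite /= mulVg.
Qed.

Lemma nbhs_eqmodl (x : X) (N : set X) :
  normal_subgroup N -> nbhs 1 N -> nbhs x (eqmod N ^~ x).
Proof.
move=> nN /(nbhs_eqmod x); apply: filterS => y; exact: eqmod_sym.
Qed.

Lemma nbhs_translate (x : X) (V : set X) :
  nbhs x V -> nbhs 1 [set y | V (x * y)].
Proof.
move=> Vx.
have cx : (fun y : X => x * y) @ (1 : X) --> x * 1.
  by apply: cvg_mulg; [exact: cvg_cst|exact: cvg_id].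
by apply: cx; rewrite /= mulg1.
Qed.

Lemma normal_subgroup_open (N : set X) :
  normal_subgroup N -> nbhs 1 N -> open N.
Proof.
move=> nN oN; rewrite openE => x Nx; apply: filterS (nbhs_eqmod x oN) => y xy.
by rewrite -[y](mulVKg x); exact: normal_subgroupM.
Qed.

(** Smallness enters here: the indices [k <= n] give only finitely many subgroups to intersect. *)
Lemma core_nbhs n : small X -> nbhs (1 : X) (core n).
Proof.
move=> sX.
pose D := [set N : set X | [/\ normal_subgroup N, nbhs 1 N & index_le n N]].
have finD : finite_set D.
  apply: sub_finite_set (_ : D `<=` \bigcup_(k in `I_n.+1)
    [set N : set X | [/\ open N, normal_subgroup N & lcosets N #= `I_k]]) _.
    move=> N [nN oN /(index_le_card nN)[k kn Nk]]; exists k => //.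
    by split=> //; exact: normal_subgroup_open.
  by apply: bigcup_finite => // k _; exact: sX.
rewrite (_ : core n = \bigcap_(N in D) N); last first.
  by apply/seteqP; split=> x Cx N => [[]|nN oN iN]; apply: Cx.
have /finite_fsetP[E DE] := finD.
by rewrite DE; apply: filter_bigI => N; move: DE => /seteqP[_ /(_ N)] /[apply] -[].
Qed.

End Core.

(** * Separation by open normal subgroups *)

Lemma compact_finite_index (X : topologicalGroupType) (N : set X) :
  compact [set: X] -> normal_subgroup N -> nbhs 1 N ->
  exists (k : nat) (c : X -> 'I_k), forall x y, c x = c y <-> eqmod N x y.
Proof.
move=> /compact_near_coveringP cX nN oN.
(* Finite lists ordered by inclusion: compactness yields a list [s] meeting every coset. *)
pose F := filter_from [set: seq X] (fun s => [set s' : seq X | {subset s <= s'}]).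
have FF : Filter F.
  apply: filter_from_filter; first by exists [::].
  move=> s1 s2 _ _; exists (s1 ++ s2) => // s s12.
  by split=> x xs; apply: s12; rewrite mem_cat xs ?orbT.
have [x _|s _ sP] := cX _ F (fun s x => exists2 y, y \in s & eqmod N y x) FF.
  exists (eqmod N x, [set s | {subset [:: x] <= s}]) => /=.
    by split; [exact: nbhs_eqmod|exists [:: x]].
  by move=> [x' s'] /= [xx' xs']; exists x => //; apply: xs'; rewrite inE.
have {sP}cov x : has (fun y => `[< eqmod N y x >]) s.
  have [y ys /asboolP yx] := sP s (fun _ => id) x I.
  by apply/hasP; exists y.
(* A coset is labelled by the position of its first representative in [s]. *)
pose c x := find (fun y => `[< eqmod N y x >]) s.
have cP x : (c x < size s)%N by rewrite -has_find.
exists (size s), (fun x => Ordinal (cP x)) => x y; split=> [/(congr1 val) /= cxy|xy].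
- have /asboolP xE := nth_find 1 (cov x); have /asboolP yE := nth_find 1 (cov y).
  move: xE yE; rewrite -/(c x) -/(c y) cxy => xE; apply: eqmod_trans => //.
  exact: eqmod_sym.
- apply: val_inj => /=; apply: eq_find => z; apply: asbool_equiv_eq.
  by split=> zx; apply: (eqmod_trans nN zx) => //; exact: eqmod_sym.
Qed.

(* The witness is the syntactic kernel of a clopen neighbourhood [U] of [1]: the
   elements that can be inserted anywhere without changing membership in [U]. *)
Lemma profinite_separation (X : topologicalGroupType) (x : X) :
  profinite X -> x != 1 ->
  exists N : set X, [/\ normal_subgroup N, nbhs 1 N & ~ N x].
Proof.
move=> [hX cX tdX] x1.
have [|U [[oU clU] U1 nUx]] :=
  totally_disconnected_zero_dimensional hX cX tdX (x := 1) (y := x).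
  by rewrite eq_sym.
pose N := [set g : X | forall y z, U (y * z) <-> U (y * g * z)].
exists N; split; last first.
- by move=> /(_ 1 1); rewrite !mul1g !mulg1 => -[/(_ U1)].
- have /compact_near_coveringP cXX := compact_setX cX cX.
  (* Compactness of [X * X] gives one neighbourhood of [1] valid for all [y] and [z] at once. *)
  have : \forall g \near (1 : X),
      [set: X] `*` [set: X] `<=` [set p | U (p.1 * p.2) <-> U (p.1 * g * p.2)].
    apply: cXX => -[y z] _.
    pose p : ((X * X) * X)%type := (y, z, 1).
    change (nbhs p [set w | U (w.1.1 * w.1.2) <-> U (w.1.1 * w.2 * w.1.2)]).
    have FF : Filter (nbhs p) by exact: nbhs_filter.
    have c11 : (fun w => w.1.1) @ p --> y by exact: cvg_comp cvg_fst cvg_fst.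
    have c12 : (fun w => w.1.2) @ p --> z by exact: cvg_comp cvg_fst cvg_snd.
    have c2 : (fun w => w.2) @ p --> (1 : X) by exact: cvg_snd.
    have mul2 : (fun w => w.1.1 * w.1.2) @ p --> y * z by exact: cvg_mulg c11 c12.
    have mul3 : (fun w => w.1.1 * w.2 * w.1.2) @ p --> y * z.
      by rewrite -[in X in _ --> X](mulg1 y); exact: cvg_mulg (cvg_mulg c11 c2) c12.
    have [Uyz|nUyz] := pselect (U (y * z)).
      have nU : nbhs (y * z) U by exact: open_nbhs_nbhs.
      have W := @filterI _ _ FF _ _ (mul2 _ nU) (mul3 _ nU).
      by apply: filterS W => w [].
    have nU : nbhs (y * z) (~` U).
      by apply: open_nbhs_nbhs; split=> //; exact: closed_openC.
    have W := @filterI _ _ FF _ _ (mul2 _ nU) (mul3 _ nU).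
    by apply: filterS W => w [].
  by apply: filterS => g Ng y z; exact: (Ng (y, z)).
- apply: normal_subgroup_intro.
  + by move=> y z; rewrite mulg1.
  + by move=> g Ng y z; rewrite (Ng (y * g^-1) z) mulgVK.
  + move=> g h Ng Nh y z; rewrite mulgA -(Nh (y * g) z) .
    exact: Ng.
  + move=> g h Ng y z.
    have := Ng (y * h^-1) (h * z).
    by rewrite conjgE !mulgA mulgVK.
Qed.

(** By compactness a separating open normal subgroup has some finite index [k], so it contains
    [core k]. *)
Lemma core_separation (X : topologicalGroupType) (x y : X) :
  profinite X -> (forall n, eqmod (core n) x y) -> x = y.
Proof.
move=> pX xy; apply: contrapT => nxy.
have [|N [nN oN]] := profinite_separation pX (x := x^-1 * y).
  by apply: contra_notN nxy => /eqP /(congr1 (fun z => x * z)); rewrite mulVKg mulg1.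
apply; have [_ cX _] := pX; have [k [c cN]] := compact_finite_index cX nN oN.
by apply: (xy k) => //; exists c => u v /cN.
Qed.

(** The cores decrease to the trivial subgroup, so by compactness they eventually avoid the
    complement of [V^°]. *)
Lemma core_basis (X : topologicalGroupType) (V : set X) :
  small_profinite X -> nbhs 1 V -> exists n, core n `<=` V.
Proof.
move=> [pX sX] V1; have [hX cX _] := pX.
have /compact_near_coveringP cV : compact (~` V^°).
  by apply: (subclosed_compact _ cX) => //; apply: open_closedC; exact: open_interior.
have [n _ /(_ n (leqnn n)) nV] : \forall n \near \oo, ~` V^° `<=` ~` @core X n.
  apply: cV => x nVx.
  have [m nmx] : exists m, ~ core m x.
    apply: contrapT => /forallNP cx; apply: nVx.
    rewrite -(core_separation (x := 1) (y := x) pX) => [|m]; first exact: V1.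
    by apply/eqmod1; apply: contrapT; exact: cx.
  exists (eqmod (core m) x, [set n | (m <= n)%N]) => /=.
    by split; [apply: nbhs_eqmod; exact: core_nbhs|exists m].
  move=> [y n] /= [xy mn] ny; apply: nmx.
  have nm := core_normal X m.
  apply/(@eqmod1 X (core m)); apply: (eqmod_trans nm (y := y)); last exact: (eqmod_sym nm).
  by apply/eqmod1; exact: core_le mn _ ny.
exists n => x nx.
by apply: interior_subset; apply: contrapT => /nV.
Qed.

(** * Functoriality of cores *)

Definition hom_mod (X Y : groupType) (N : set Y) (t : X -> Y) : Prop :=
  forall x y, eqmod N (t (x * y)) (t x * t y).

(** Each [N] in the definition of [core n] contains [core n], so a map multiplicative modulo
    [core n] pulls [N] back to a normal subgroup, and composing labellings bounds its index. *)
Lemma core_functorial (X Y : topologicalGroupType) (n : nat) (t : X -> Y) :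
  hom_mod (core n) t ->
  (forall N, core n `<=` N -> nbhs 1 N -> nbhs 1 (t @^-1` N)) ->
  forall x, core n x -> core n (t x).
Proof.
move=> tM tc x Cx N nN oN iN.
have CN : @core Y n `<=` N by move=> y; apply.
have {}tM y z : eqmod N (t (y * z)) (t y * t z) by apply: CN; exact: tM.
have tr := @eqmod_trans _ _ nN; have sy := @eqmod_sym _ _ nN.
have rf := @eqmod_refl _ _ nN.
have t1 : N (t 1).
  by have := tM 1 1; rewrite mulg1 /eqmod mulKg.
have tV y : eqmod N (t y^-1) (t y)^-1.
  have := tM y^-1 y; rewrite mulVg => /(eqmodM nN) /(_ (rf (t y)^-1)).
  rewrite mulgK => /sy yy; apply: (tr _ _ _ yy).
  by rewrite -[X in eqmod N _ X]mul1g; apply: eqmodM => //; apply/sy/eqmod1.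
apply: (Cx (t @^-1` N)).
- apply: normal_subgroup_intro => //= [y Ny|y z Ny Nz|y z Ny].
  + apply/eqmod1; apply: (tr _ _ _ _ (sy _ _ (tV y))).
    by apply/eqmod1; exact: normal_subgroupV.
  + apply/eqmod1; apply: (tr _ _ _ _ (sy _ _ (tM y z))).
    by apply/eqmod1; exact: normal_subgroupM.
  + apply/eqmod1; rewrite conjgE; apply: (tr _ _ _ _ (sy _ _ (tM _ _))).
    apply: (tr _ ((t y) ^ (t z))); first by apply/eqmod1; exact: normal_subgroupJ.
    by rewrite conjgE; apply: eqmodM => //; apply: sy.
- exact: tc.
- case: iN => c cN; exists (c \o t) => y z /cN yz.
  suff : N (t (y^-1 * z)) by [].
  apply/eqmod1; apply: (tr _ _ _ _ (sy _ _ (tM _ _))).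
  apply: (tr _ ((t y)^-1 * t z)); first exact/eqmod1.
  by apply: eqmodM => //; exact: sy.
Qed.

Lemma core_continuous (X Y : topologicalGroupType) (n : nat) (f : X -> Y) :
  {morph f : x y / x * y} -> continuous f -> forall x, core n x -> core n (f x).
Proof.
move=> fM fc; apply: core_functorial => [x y|N _ N1].
  by rewrite fM; apply: eqmod_refl; exact: core_normal.
by apply: fc; rewrite (morph_oneg fM).
Qed.

(** Functoriality for the projections and for the two inclusions of the factors. *)
Lemma core_pair (X Y : topologicalGroupType) (n : nat) (x : X) (y : Y) :
  core n (x, y) <-> core n x /\ core n y.
Proof.
split=> [xy|[Cx Cy]].
  split.
    by apply: (core_continuous (f := @fst X Y)) xy => // z; exact: cvg_fst.
  by apply: (core_continuous (f := @snd X Y)) xy => // z; exact: cvg_snd.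
have inl : core n (x, 1 : Y).
  apply: (core_continuous (f := fun z : X => (z, 1 : Y))) Cx.
    by move=> u v; congr (_, _); rewrite mulg1.
  by move=> z; apply: cvg_pair; [exact: cvg_id|exact: cvg_cst].
have inr : core n (1 : X, y).
  apply: (core_continuous (f := fun z : Y => (1 : X, z))) Cy.
    by move=> u v; congr (_, _); rewrite mulg1.
  by move=> z; apply: cvg_pair; [exact: cvg_cst|exact: cvg_id].
have := normal_subgroupM (core_normal _ n) inl inr.
by congr (core n (_, _)); rewrite /= ?mulg1 ?mul1g.
Qed.

(** * Finite quotients and approximate isomorphisms *)

Lemma core_quotient (X : topologicalGroupType) (n : nat) :
  small_profinite X ->
  exists (Q : finType) (p : X -> Q) (s : Q -> X),
    cancel s p /\ forall x y, p x = p y <-> eqmod (core n) x y.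
Proof.
move=> [[_ cX _] sX].
have [k [c cP]] := compact_finite_index cX (core_normal X n) (core_nbhs n sX).
(* Only the labels actually attained are kept, so that a section exists. *)
pose P i := `[< exists x, c x = i >].
have Pc x : P (c x) by apply/asboolP; exists x.
have /choice[s sP] : forall q : {i | P i}, exists x, c x = val q.
  by move=> q; exact/asboolP/(valP q).
exists {i | P i}, (fun x => exist _ (c x) (Pc x)), s.
split=> [q|x y]; first by apply: val_inj; exact: sP.
rewrite -cP; split=> [/(congr1 val)//|cxy]; exact: val_inj.
Qed.

(* Set-theoretic lifts of mutually inverse isomorphisms between [A / core n] and
   [B / core n]. *)
Record approx_iso (A B : topologicalGroupType) (n : nat)
    (t : A -> B) (s : B -> A) : Prop := ApproxIso {
  approx_hom : hom_mod (core n) t ;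
  approx_hom_inv : hom_mod (core n) s ;
  approx_const : forall x y, eqmod (core n) x y -> t x = t y ;
  approx_const_inv : forall x y, eqmod (core n) x y -> s x = s y ;
  approxK : forall x, eqmod (core n) (s (t x)) x ;
  approxVK : forall y, eqmod (core n) (t (s y)) y
}.

Lemma approx_iso_sym (A B : topologicalGroupType) (n : nat)
    (t : A -> B) (s : B -> A) : approx_iso n t s -> approx_iso n s t.
Proof. by case. Qed.

(** Constancy on the cosets of the open subgroup [core n] supplies the continuity that functoriality
    asks for. *)
Lemma approx_iso_core (A B : topologicalGroupType) (m n : nat)
    (t : A -> B) (s : B -> A) :
  small A -> approx_iso n t s -> (m <= n)%N ->
  forall x, core m x -> core m (t x).
Proof.
move=> sA [tM _ tc _ _ _] mn; apply: core_functorial => [x y|N mN N1].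
  exact: core_le mn _ (tM x y).
have t1 : core n (t 1) by have := tM 1 1; rewrite mulg1 /eqmod mulKg.
apply: filterS (core_nbhs n sA) => x nx /=.
rewrite -(tc 1); first by apply: mN; exact: core_le mn _ t1.
exact/eqmod1.
Qed.

Lemma approx_iso_exists (G A B : topologicalGroupType) (n : nat) :
  small_profinite G -> small_profinite A -> small_profinite B ->
  isomorphic (G * A)%type (G * B)%type ->
  exists (t : A -> B) (s : B -> A), approx_iso n t s.
Proof.
move=> spG spA spB [f [g [fc gc fgK gfK]]].
have [QG [pG [sG [sGK pGE]]]] := core_quotient n spG.
have [QA [pA [sA [sAK pAE]]]] := core_quotient n spA.
have [QB [pB [sB [sBK pBE]]]] := core_quotient n spB.
pose mG i j := pG (sG i * sG j).
pose mA i j := pA (sA i * sA j).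
pose mB i j := pB (sB i * sB j).
have opE (Y : topologicalGroupType) (Q : finType) (p : Y -> Q) (s : Q -> Y) :
    cancel s p -> (forall x y, p x = p y <-> eqmod (core n) x y) ->
    forall x y, p (x * y) = p (s (p x) * s (p y)).
  move=> sK pE x y; have spE z : eqmod (core n) z (s (p z)) by apply/pE; rewrite sK.
  by apply/pE; exact: (eqmodM (core_normal Y n) (spE x) (spE y)).
have mGE : forall x y, pG (x * y) = mG (pG x) (pG y) by exact: opE sGK pGE.
have mAE : forall x y, pA (x * y) = mA (pA x) (pA y) by exact: opE sAK pAE.
have mBE : forall x y, pB (x * y) = mB (pB x) (pB y) by exact: opE sBK pBE.
pose phi (q : QG * QA) := let w := f (sG q.1, sA q.2) in (pG w.1, pB w.2).
pose psi (q : QG * QB) := let w := g (sG q.1, sB q.2) in (pG w.1, pA w.2).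
(* Independence of representatives: this lets [f] and [g] descend to [phi] and [psi]. *)
have cong (H K L M : topologicalGroupType)
    (h : {multiplicative H * K -> L * M}) : continuous h ->
    forall x x' y y', eqmod (core n) x x' -> eqmod (core n) y y' ->
    eqmod (core n) (h (x, y)).1 (h (x', y')).1 /\
    eqmod (core n) (h (x, y)).2 (h (x', y')).2.
  move=> hc x x' y y' xx' yy'.
  have hM : {morph h : u v / u * v} by move=> u v; rewrite gmulfM.
  have : core n ((x, y)^-1 * (x', y')) by apply/core_pair.
  move=> /(core_continuous hM hc); rewrite hM (morph_invg hM).
  by rewrite [X in core _ X]surjective_pairing => /core_pair.
have phiE x y : phi (pG x, pA y) = (pG (f (x, y)).1, pB (f (x, y)).2).
  have [] := cong _ _ _ _ f fc (sG (pG x)) x (sA (pA y)) y.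
  - by apply/pGE; rewrite sGK.
  - by apply/pAE; rewrite sAK.
  by move=> /pGE e1 /pBE e2; rewrite /phi /= e1 e2.
have psiE x y : psi (pG x, pB y) = (pG (g (x, y)).1, pA (g (x, y)).2).
  have [] := cong _ _ _ _ g gc (sG (pG x)) x (sB (pB y)) y.
  - by apply/pGE; rewrite sGK.
  - by apply/pBE; rewrite sBK.
  by move=> /pGE e1 /pAE e2; rewrite /psi /= e1 e2.
have phiK : cancel phi psi.
  move=> [i j]; rewrite -(sGK i) -(sAK j) phiE psiE.
  by rewrite -surjective_pairing fgK.
have psiK : cancel psi phi.
  move=> [i j]; rewrite -(sGK i) -(sBK j) psiE phiE.
  by rewrite -surjective_pairing gfK.
have phiM : op_hom (prod_op mG mA) (prod_op mG mB) phi.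
  move=> [i j] [i' j'].
  rewrite -(sGK i) -(sAK j) -(sGK i') -(sAK j') /prod_op /= -mGE -mAE !phiE /=.
  have fM : f (sG i * sG i', sA j * sA j') = f (sG i, sA j) * f (sG i', sA j').
    by rewrite -gmulfM.
  by rewrite -mGE -mBE fM !sGK !sAK.
have psiM : op_hom (prod_op mG mB) (prod_op mG mA) psi.
  by move=> p q; apply: (can_inj phiK); rewrite psiK phiM !psiK.
have [|t [s [tM sM tK sK]]] := finite_cancellation (e := pG 1) _
  (can_inj phiK) phiM (can_inj psiK) psiM.
  by rewrite -mGE mulg1.
exists (sB \o t \o pA), (sA \o s \o pB); split=> [x y|x y|x y|x y|x|y] /=.
- by apply/pBE; rewrite mBE !sBK mAE tM.
- by apply/pAE; rewrite mAE !sAK mBE sM.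
- by move=> /pAE ->.
- by move=> /pBE ->.
- by apply/pAE; rewrite sAK sBK tK.
- by apply/pBE; rewrite sBK sAK sK.
Qed.

(** * Limits along an ultrafilter *)

Lemma ultralimit_hom (A B : topologicalGroupType) (U : set_system nat)
    (t : nat -> A -> B) :
  small_profinite A -> small_profinite B -> UltraFilter U -> \oo `<=` U ->
  (forall n, hom_mod (core n) (t n)) ->
  (forall m n, (m <= n)%N -> forall x, core m x -> core m (t n x)) ->
  exists f : A -> B, [/\ {morph f : x y / x * y}, continuous f &
    forall x m, U [set n | eqmod (core m) (t n x) (f x)]].
Proof.
move=> spA spB UU Uoo tM tcore.
have [pA sA] := spA; have [pB sB] := spB; have [_ cB _] := pB.
have Uge m : U [set n | (m <= n)%N] by apply: Uoo; exists m.
have /choice[f fP] : forall x, exists y,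
    forall m, U [set n | eqmod (core m) (t n x) y].
  move=> x.
  (* A cluster point of the image of an ultrafilter is a limit, here tested on cosets of the
     cores. *)
  have [|y [_ yU]] := cB ((fun n => t n x) @ U) _; first exact: filterT.
  exists y => m.
  have Ny : nbhs y (eqmod (core m) ^~ y).
    by apply: nbhs_eqmodl; [exact: core_normal|exact: core_nbhs].
  have [//|Uc] := in_ultra_setVsetC [set n | eqmod (core m) (t n x) y] UU.
  by have [z []] := yU (~` (eqmod (core m) ^~ y)) _ Uc Ny.
have fM : {morph f : x y / x * y}.
  move=> x y; apply: core_separation => // m.
  have nm := core_normal B m.
  (* A single [n >= m] approximates [f] at all three points, and [t n] is multiplicative modulo
     [core m]. *)
  have [n [/= mn [fxy [fx fy]]]] := filter_ex
    (filterI (Uge m) (filterI (fP (x * y) m) (filterI (fP x m) (fP y m)))).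
  apply: (eqmod_trans nm (eqmod_sym nm fxy)).
  apply: (eqmod_trans nm (core_le mn (tM n x y))).
  exact: (eqmodM nm fx fy).
exists f; split=> // x V Vfx.
have [m mV] := core_basis spB (nbhs_translate Vfx).
apply: filterS (nbhs_eqmod x (core_nbhs m sA)) => y xy.
(* Continuity holds because [f] maps [core m] into itself, a property inherited from [t n] for
   [n >= m]. *)
suff fxy : core m ((f x)^-1 * f y) by have := mV _ fxy; rewrite /= mulVKg.
rewrite -(morph_invg fM) -fM.
have nm := core_normal B m.
have [n [/= mn txy]] := filter_ex (filterI (Uge m) (fP (x^-1 * y) m)).
apply/(@eqmod1 _ (core m)); apply: (eqmod_trans nm _ txy).
by apply/(@eqmod1 _ (core m)); exact: tcore xy.
Qed.

Theorem proposition6 (G : topologicalGroupType) (hG : small_profinite G) :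
  cancellable small_profinite G.
Proof.
move=> A B spA spB isoGAB.
have [pA sA] := spA; have [pB sB] := spB.
have /choice[t /choice[s ts]] : forall n, exists t : A -> B, exists s : B -> A,
    approx_iso n t s.
  by move=> n; exact: approx_iso_exists isoGAB.
(* Refining [\oo] puts every tail of [nat] in [U], so only levels [n >= m] matter modulo
   [core m]. *)
have [U [UU Uoo]] := ultraFilterLemma eventually_filter.
have Uge m : U [set n | (m <= n)%N] by apply: Uoo; exists m.
have tcore m n mn := approx_iso_core sA (ts n) (m := m) mn.
have score m n mn := approx_iso_core sB (approx_iso_sym (ts n)) (m := m) mn.
have [f [fM fc fP]] := ultralimit_hom spA spB UU Uoo
  (fun n => approx_hom (ts n)) tcore.
have [g [gM gc gP]] := ultralimit_hom spB spA UU Uoo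
  (fun n => approx_hom_inv (ts n)) score.
have limK (X Y : topologicalGroupType) (p : nat -> X -> Y) (q : nat -> Y -> X)
    (u : X -> Y) (v : Y -> X) : profinite X ->
    (forall n, approx_iso n (p n) (q n)) ->
    (forall m n, (m <= n)%N -> forall y, core m y -> core m (q n y)) ->
    (forall x m, U [set n | eqmod (core m) (p n x) (u x)]) ->
    (forall y m, U [set n | eqmod (core m) (q n y) (v y)]) ->
    cancel u v.
  move=> pX pq qcore uP vP x; apply: core_separation => // m.
  have nm := core_normal X m.
  have [n [/= mn [ux vux]]] :=
    filter_ex (filterI (Uge m) (filterI (uP x m) (vP (u x) m))).
  apply: (eqmod_trans nm (eqmod_sym nm vux)).
  have [_ qM _ _ qpK _] := pq n.
  apply: (eqmod_trans nm _ (core_le mn (qpK x))).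
  (* Here [u x] is [p n x] times an element of [core m], which [q n] sends into [core m]. *)
  have := qM (p n x) ((p n x)^-1 * u x); rewrite mulVKg => /(core_le mn) qux.
  apply: (eqmod_trans nm qux).
  exact: (eqmod_sym nm (eqmod_mulr _ (qcore _ _ mn _ ux))).
pose F : {multiplicative A -> B} := HB.pack f (isMultiplicative.Build A B f fM).
pose H : {multiplicative B -> A} := HB.pack g (isMultiplicative.Build B A g gM).
exists F, H; split=> //.
- exact: limK pA ts score fP gP.
- exact: limK pB (fun n => approx_iso_sym (ts n)) tcore gP fP.
Qed.
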